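(* Let $\mathbb{K}$ be a field of characteristic different from $2$ and let $\mathcal{A}$ be a finite-dimensional $\mathbb{K}$-superalgebra which is (super)symmetric with a (super)symmetrizing form $t$ and which is split. Then: (1) If $t$ is symmetric, then $\mathcal{A}$ is semisimple if and only if all Schur elements of simple $\mathcal{A}$-modules are non-zero. (2) If $t$ is supersymmetric, then $\mathcal{A}$ is semisimple if and only if all simple $\mathcal{A}$-modules are of type $\mathtt{M}$ and all Schur elements of simple $\mathcal{A}$-modules are non-zero.
   Context: A superalgebra is a $\mathbb{Z}_2$-graded associative algebra; modules over it are $\mathbb{Z}_2$-graded (finite-dimensional) left modules, and a homogeneous homomorphism $f$ satisfies $f(av)=(-1)^{|f||a|}af(v)$ (general homomorphisms are sums of homogeneous ones). $\mathcal{A}$ is semisimple if its ordinary (ungraded) Jacobson radical is $0$. A simple module is split if it stays simple after every field extension; $\mathcal{A}$ is split if all its simple modules are. For split $\mathcal{A}$, a simple module is of type $\mathtt{M}$ (resp. $\mathtt{Q}$) if its full super endomorphism algebra is one-dimensional (resp. two-dimensional). A symmetrizing form is a linear $t:\mathcal{A}\to\mathbb{K}$ that vanishes on $\mathcal{A}_{\bar1}$, is non-degenerate (the matrix $(t(b_1b_2))_{b_1,b_2\in\mathcal{B}}$ is invertible for a homogeneous basis $\mathcal{B}$) and satisfies $t(xy)=t(yx)$ for all $x,y$; a supersymmetrizing form is the same with $t(xy)=(-1)^{|x||y|}t(yx)$ for homogeneous $x,y$. $\mathcal{A}$ is (super)symmetric if it has such a form; ''$t$ is symmetric/supersymmetric''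 says which case holds. Schur elements: let $\mathcal{B}$ be a homogeneous basis with dual basis $\{b^\vee\}$, $t(b^\vee b')=\delta_{b,b'}$. For a module $V$ and even linear $f\in\mathrm{End}_{\mathbb{K}}(V)_{\bar0}$ put $I(f)(v)=\sum_bb^\vee f(bv)$ ($t$ symmetric), $I(f)(v)=\sum_b(-1)^{|b|}b^\vee f(bv)$ ($t$ supersymmetric). If $t$ is symmetric and $V$ is split simple, $s_V\in\mathbb{K}$ is the unique element with $I(f)=s_V\mathrm{tr}(f)\mathrm{id}_V$ for all even $f$. If $t$ is supersymmetric and $V$ is split simple of type $\mathtt{M}$, $s_V$ is the unique element with $I(f)=s_V\mathrm{suptr}(f)\mathrm{id}_V$ for all even $f$, $\mathrm{suptr}(f)=\mathrm{tr}(f|_{V_{\bar0}})-\mathrm{tr}(f|_{V_{\bar1}})$ (well defined up to sign on isomorphism classes). *)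

(* Defs.v *)
From HB Require Import structures.
From mathcomp Require Import all_boot all_algebra falgebra.

Set Implicit Arguments.
Unset Strict Implicit.
Unset Printing Implicit Defensive.

Import GRing.Theory.
Local Open Scope ring_scope.

(** Z/2-gradings are indexed by [bool]: [false] is even, [true] is odd, degrees
    add with [addb], and [(-1) ^+ (p && q)] is the sign (-1)^(pq). *)

Section Gradings.
Variables (K : fieldType) (V : vectType K).

Definition grading (G : bool -> {vspace V}) : Prop :=
  (G false + G true)%VS = fullv /\ (G false :&: G true)%VS = 0%VS.

Definition graded_subspace (G : bool -> {vspace V}) (W : {vspace V}) : Prop :=
  W = (W :&: G false + W :&: G true)%VS.

End Gradings.

(** [falgType K] is the type of finite-dimensional unital algebras with 1 != 0.
    That 1 is even follows from the grading axioms. *)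
Record superalgebra (K : fieldType) := SuperAlgebra {
  salg_sort :> falgType K;
  salg_part : bool -> {vspace salg_sort};
  salg_grading : grading salg_part;
  salg_mul_part : forall p q x y,
    x \in salg_part p -> y \in salg_part q -> x * y \in salg_part (p (+) q)
}.

Record supermodule (K : fieldType) (A : superalgebra K) := SuperModule {
  smod_sort :> vectType K;
  smod_part : bool -> {vspace smod_sort};
  smod_act : {linear A -> 'End(smod_sort)};
  smod_grading : grading smod_part;
  smod_act1 : smod_act 1 = \1%VF;
  smod_actM : forall a b, smod_act (a * b) = (smod_act a \o smod_act b)%VF;
  smod_act_part : forall p q a v,
    a \in salg_part A p -> v \in smod_part q ->
    smod_act a v \in smod_part (p (+) q)
}.

Arguments salg_part {K} A p : rename.
Arguments smod_part {K A} V p : rename.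
Arguments smod_act {K A} V : rename.

Section Modules.
Variables (K : fieldType) (A : superalgebra K).

Definition subsupermodule (V : supermodule A) (W : {vspace V}) : Prop :=
  graded_subspace (smod_part V) W /\
  forall a w, w \in W -> smod_act V a w \in W.

Definition simple_supermodule (V : supermodule A) : Prop :=
  fullv <> 0%VS :> {vspace V} /\
  forall W : {vspace V}, subsupermodule W -> W = 0%VS \/ W = fullv.

Definition homogeneous_endo (V : supermodule A) (p : bool) (f : 'End(V)) : Prop :=
  (forall q v, v \in smod_part V q -> f v \in smod_part V (p (+) q)) /\
  (forall q a v, a \in salg_part A q ->
     f (smod_act V a v) = (-1) ^+ (p && q) *: smod_act V a (f v)).

Definition super_endo (V : supermodule A) (f : 'End(V)) : Prop :=
  exists f0 f1 : 'End(V),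
    [/\ f = f0 + f1, homogeneous_endo false f0 & homogeneous_endo true f1].

(** The superalgebra of (not necessarily even) endomorphisms of [V] is
    one-dimensional. *)
Definition typeM (V : supermodule A) : Prop :=
  exists2 E : {vspace 'End(V)},
    (forall f, f \in E <-> super_endo f) & \dim E = 1%N.

End Modules.

Section Radical.
Variables (K : fieldType) (A : falgType K).

(** As [A] is unital, its left ideals are automatically subspaces. *)
Definition left_ideal (I : {vspace A}) : Prop :=
  forall a x, x \in I -> a * x \in I.

Definition maximal_left_ideal (I : {vspace A}) : Prop :=
  [/\ left_ideal I, I <> fullv &
      forall J : {vspace A}, left_ideal J -> (I <= J)%VS -> J = I \/ J = fullv].

Definition in_jacobson_radical (x : A) : Prop :=
  forall I, maximal_left_ideal I -> x \in I.

Definition semisimple : Prop := forall x, in_jacobson_radical x -> x = 0.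

End Radical.

Section BaseChangeSpace.
Variables (K L : fieldType) (iota : {rmorphism K -> L}).
Implicit Types U V W : vectType K.

(** L ⊗ V, in the coordinates of the K-basis [vbasis fullv] of V. *)
Local Notation bc_space V := 'rV[L]_(\dim {: V}).

(** v |-> 1 ⊗ v *)
Definition bc_vec V (v : V) : bc_space V :=
  \row_i iota (coord (vbasis {: V}) i v).

(** L ⊗ U, as a subspace of L ⊗ V *)
Definition bc_sub V (U : {vspace V}) : {vspace bc_space V} :=
  <<[seq bc_vec u | u <- vbasis U]>>%VS.

(** id ⊗ f : L ⊗ V -> L ⊗ W *)
Definition bc_hom V W (f : 'Hom(V, W)) : 'Hom(bc_space V, bc_space W) :=
  linfun (mulmxr (\matrix_i bc_vec (f (vbasis {: V})`_i))).

(** The L-linear map L ⊗ U -> Hom_L(L ⊗ V, L ⊗ W) with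
    1 ⊗ u |-> id ⊗ rho u *)
Definition bc_act U V W (rho : {linear U -> 'Hom(V, W)}) (x : bc_space U)
    : 'Hom(bc_space V, bc_space W) :=
  \sum_i x 0 i *: bc_hom (rho (vbasis {: U})`_i).

Lemma bc_vecP V a (u v : V) :
  bc_vec (a *: u + v) = iota a *: bc_vec u + bc_vec v.
Proof. by apply/rowP=> i; rewrite !mxE linearP rmorphD rmorphM. Qed.

Lemma bc_vec0 V : bc_vec (0 : V) = 0.
Proof. by apply/rowP=> i; rewrite !mxE linear0 rmorph0. Qed.

Lemma bc_vec_sum V n (c : 'I_n -> K) (v : 'I_n -> V) :
  bc_vec (\sum_i c i *: v i) = \sum_i iota (c i) *: bc_vec (v i).
Proof.
elim/big_rec2: _ => [|i y1 y2 _ <-]; first exact: bc_vec0.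
by rewrite bc_vecP.
Qed.

Lemma bc_vec_basis V (i : 'I_(\dim {: V})) :
  bc_vec (vbasis {: V})`_i = delta_mx 0 i.
Proof.
apply/rowP=> j; rewrite !mxE eqxx /= coord_free ?(basis_free (vbasisP _)) //.
by rewrite rmorph_nat eq_sym.
Qed.

Lemma bc_space_sum V (x : bc_space V) :
  x = \sum_i x 0 i *: bc_vec (vbasis {: V})`_i.
Proof.
rewrite [LHS](row_sum_delta x).
by apply: eq_bigr => i _; rewrite bc_vec_basis.
Qed.

Lemma bc_vec_inj V : injective (@bc_vec V).
Proof.
move=> u v /rowP euv; rewrite (coord_vbasis (memvf u)) (coord_vbasis (memvf v)).
apply: eq_bigr => i _; congr (_ *: _).
by have := euv i; rewrite !mxE => /fmorph_inj.
Qed.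

Lemma bc_ext V (E : lmodType L) (g h : bc_space V -> E) :
  linear g -> linear h -> (forall v, g (bc_vec v) = h (bc_vec v)) -> g =1 h.
Proof.
move=> gl hl gh x.
pose gL : {linear _ -> _} := HB.pack g (GRing.isLinear.Build _ _ _ _ _ gl).
pose hL : {linear _ -> _} := HB.pack h (GRing.isLinear.Build _ _ _ _ _ hl).
rewrite -[g]/(gL : _ -> _) -[h]/(hL : _ -> _) (bc_space_sum x) !linear_sum.
by apply: eq_bigr => i _; rewrite !linearZ /= gh.
Qed.

Lemma bc_homE V W (f : 'Hom(V, W)) v : bc_hom f (bc_vec v) = bc_vec (f v).
Proof.
rewrite lfunE /= mulmx_sum_row [in RHS](coord_vbasis (memvf v)) linear_sum /=.
under [in RHS]eq_bigr do rewrite linearZ /=.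
rewrite bc_vec_sum.
by apply: eq_bigr => i _; rewrite rowK mxE.
Qed.

Lemma bc_lfunP V (E : vectType L) (g h : 'Hom(bc_space V, E)) :
  (forall v, g (bc_vec v) = h (bc_vec v)) -> g = h.
Proof. by move=> gh; apply/lfunP; apply: bc_ext gh => a u v; rewrite linearP. Qed.

Lemma bc_homP V W a (f g : 'Hom(V, W)) :
  bc_hom (a *: f + g) = iota a *: bc_hom f + bc_hom g.
Proof.
apply: bc_lfunP => v; rewrite add_lfunE scale_lfunE !bc_homE.
by rewrite add_lfunE scale_lfunE bc_vecP.
Qed.

Lemma bc_hom0 V W : bc_hom (0 : 'Hom(V, W)) = 0.
Proof. by apply: bc_lfunP => v; rewrite bc_homE !zero_lfunE bc_vec0. Qed.

Lemma bc_hom1 V : bc_hom (\1%VF : 'End(V)) = \1%VF.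
Proof. by apply: bc_lfunP => v; rewrite bc_homE !id_lfunE. Qed.

Lemma bc_hom_comp U V W (f : 'Hom(V, W)) (g : 'Hom(U, V)) :
  bc_hom (f \o g)%VF = (bc_hom f \o bc_hom g)%VF.
Proof. by apply: bc_lfunP => v; rewrite comp_lfunE !bc_homE comp_lfunE. Qed.

Lemma bc_act_linear U V W (rho : {linear U -> 'Hom(V, W)}) :
  linear (bc_act rho).
Proof.
move=> a x y; rewrite /bc_act scaler_sumr -big_split /=.
by apply: eq_bigr => i _; rewrite !mxE scalerDl scalerA.
Qed.

HB.instance Definition _ U V W (rho : {linear U -> 'Hom(V, W)}) :=
  GRing.isLinear.Build L (bc_space U) 'Hom(bc_space V, bc_space W) *:%R
    (bc_act rho) (bc_act_linear rho).

Lemma bc_actE U V W (rho : {linear U -> 'Hom(V, W)}) u :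
  bc_act rho (bc_vec u) = bc_hom (rho u).
Proof.
rewrite /bc_act [in RHS](coord_vbasis (memvf u)) linear_sum /=.
transitivity (\sum_i iota (coord (vbasis {: U}) i u)
                *: bc_hom (rho (vbasis {: U})`_i)).
  by apply: eq_bigr => i _; rewrite mxE.
elim/big_rec2: _ => [|i y1 y2 _ ->]; first by rewrite bc_hom0.
by rewrite linearZ bc_homP.
Qed.

Section Bilinear.
Variables (U V W : vectType K) (rho : {linear U -> 'Hom(V, W)}).
Implicit Types (x y : bc_space U) (v w : bc_space V) (a : L).

Lemma bc_act_addl x y v : bc_act rho (x + y) v = bc_act rho x v + bc_act rho y v.
Proof.
suff -> : bc_act rho (x + y) = bc_act rho x + bc_act rho y by rewrite add_lfunE.
rewrite /bc_act -big_split /=; apply: eq_bigr => i _.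
by rewrite mxE scalerDl.
Qed.

Lemma bc_act_addr x v w : bc_act rho x (v + w) = bc_act rho x v + bc_act rho x w.
Proof. by rewrite linearD. Qed.

Lemma bc_act_scalel a x v : a *: bc_act rho x v = bc_act rho (a *: x) v.
Proof.
suff -> : bc_act rho (a *: x) = a *: bc_act rho x by rewrite scale_lfunE.
rewrite /bc_act scaler_sumr; apply: eq_bigr => i _.
by rewrite mxE scalerA.
Qed.

Lemma bc_act_scaler a x v : a *: bc_act rho x v = bc_act rho x (a *: v).
Proof. by rewrite -(linearZ_LR (bc_act rho x)). Qed.

End Bilinear.

Lemma bc_vec_sub V (U : {vspace V}) u : u \in U -> bc_vec u \in bc_sub U.
Proof.
move=> Uu; rewrite (coord_vbasis Uu) bc_vec_sum.
apply: memv_suml => i _; apply: memvZ; apply: memv_span; apply: map_f.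
exact: memt_nth.
Qed.

Lemma bc_sub_le V (U : {vspace V}) (S : {vspace bc_space V}) :
  (forall u, u \in U -> bc_vec u \in S) -> (bc_sub U <= S)%VS.
Proof. by move=> US; apply/span_subvP=> _ /mapP[u /vbasis_mem Uu ->]; apply: US. Qed.

Lemma bc_sub_grading V (G : bool -> {vspace V}) :
  grading G -> grading (fun p => bc_sub (G p)).
Proof.
case=> Gfull Gdir.
have full : (bc_sub (G false) + bc_sub (G true))%VS = fullv.
  apply/eqP; rewrite eqEsubv subvf /=; apply/subvP=> x _.
  rewrite (bc_space_sum x); apply: memv_suml => i _; apply: memvZ.
  have /memv_addP[u Gu [v Gv ->]] : (vbasis {: V})`_i \in (G false + G true)%VS.
    by rewrite Gfull memvf.
  rewrite -[u]scale1r bc_vecP rmorph1 scale1r.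
  by apply: memv_add; apply: bc_vec_sub.
split=> //; apply/eqP; rewrite -dimv_eq0 -leqn0.
have dl p : (\dim (bc_sub (G p)) <= \dim (G p))%N.
  by apply: leq_trans (dim_span _) _; rewrite size_map size_tuple.
have dimL : \dim {: bc_space V} = \dim {: V} by rewrite dimvf /dim /= mul1n.
have := dimv_sum_cap (G false) (G true); rewrite Gfull Gdir dimv0 addn0 => dimK.
have := dimv_sum_cap (bc_sub (G false)) (bc_sub (G true)).
rewrite full dimL => dimsum; rewrite -(leq_add2l (\dim {: V})) addn0 dimsum.
by apply: leq_trans (leq_add (dl false) (dl true)) _; rewrite -dimK.
Qed.

Lemma bc_act_sub U V W (rho : {linear U -> 'Hom(V, W)})
    (U' : {vspace U}) (V' : {vspace V}) (W' : {vspace W}) :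
  (forall u v, u \in U' -> v \in V' -> rho u v \in W') ->
  forall x y, x \in bc_sub U' -> y \in bc_sub V' -> bc_act rho x y \in bc_sub W'.
Proof.
move=> UVW x y Ux Vy.
pose ev (z : bc_space V) (f : 'Hom(bc_space V, bc_space W)) := f z.
have evl z : linear (ev z).
  by move=> a f g; rewrite /ev add_lfunE scale_lfunE.
pose evL z : {linear _ -> _} := HB.pack (ev z) (GRing.isLinear.Build _ _ _ _ _ (evl z)).
suff /subvP/(_ x Ux) : (bc_sub U' <= (linfun (evL y \o bc_act rho) @^-1: bc_sub W'))%VS.
  by rewrite -memv_preim lfunE.
apply: bc_sub_le => u Uu; rewrite -memv_preim lfunE /= /ev bc_actE.
suff /subvP/(_ y Vy) : (bc_sub V' <= (bc_hom (rho u) @^-1: bc_sub W'))%VS.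
  by rewrite -memv_preim.
apply: bc_sub_le => v Vv; rewrite -memv_preim bc_homE.
exact/bc_vec_sub/UVW.
Qed.

Lemma bc_actM U V (mul : {linear U -> 'End(U)}) (rho : {linear U -> 'End(V)}) :
  (forall a b, rho (mul a b) = (rho a \o rho b)%VF) ->
  forall x y, bc_act rho (bc_act mul x y) = (bc_act rho x \o bc_act rho y)%VF.
Proof.
move=> rhoM x y; move: x.
apply: bc_ext => [a x x'|a x x'|u].
- by rewrite bc_act_linear add_lfunE scale_lfunE bc_act_linear.
- by rewrite bc_act_linear comp_lfunDl comp_lfunZl.
move: y; apply: bc_ext => [a y y'|a y y'|v].
- by rewrite (linearP (bc_act mul (bc_vec u))) bc_act_linear.
- by rewrite bc_act_linear comp_lfunDr comp_lfunZr.
by rewrite !bc_actE bc_homE bc_actE rhoM bc_hom_comp.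
Qed.

End BaseChangeSpace.

(** The algebra L ⊗ A; its product is (x ⊗ a)(y ⊗ b) = xy ⊗ ab. *)
Definition bc_algebra (K L : fieldType) (iota : {rmorphism K -> L})
  (A : falgType K) : Type :=
  'rV[L]_(\dim {: A}).

Section BaseChangeAlgebra.
Variables (K L : fieldType) (iota : {rmorphism K -> L}) (A : falgType K).
Local Notation AL := (bc_algebra iota A).

HB.instance Definition _ := Vector.copy AL 'rV[L]_(\dim {: A}).

Definition bc_one : AL := bc_vec iota (1 : A).
Definition bc_mul (x y : AL) : AL := bc_act iota (@amull K A) x y.

Let mulE (a b : A) : amull a b = a * b. Proof. by rewrite lfunE. Qed.

Lemma bc_mulA : associative bc_mul.
Proof.
move=> x y z; rewrite /bc_mul bc_actM ?comp_lfunE // => a b.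
by apply/lfunP=> c; rewrite comp_lfunE !mulE mulrA.
Qed.

Lemma bc_mul1l : left_id bc_one bc_mul.
Proof.
move=> x; rewrite /bc_mul bc_actE /=.
suff -> : amull (1 : A) = \1%VF by rewrite bc_hom1 id_lfunE.
by apply/lfunP=> a; rewrite mulE mul1r id_lfunE.
Qed.

Lemma bc_mul1r : right_id bc_one bc_mul.
Proof.
apply: (@bc_ext _ _ iota A) => [a x y|//|a].
- by rewrite /bc_mul bc_act_linear add_lfunE scale_lfunE.
- by rewrite /bc_mul bc_actE bc_homE mulE mulr1.
Qed.

Lemma bc_mulDl : left_distributive bc_mul +%R.
Proof. by move=> x y z; apply: bc_act_addl. Qed.

Lemma bc_mulDr : right_distributive bc_mul +%R.
Proof. by move=> x y z; apply: bc_act_addr. Qed.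

Lemma bc_one_neq0 : bc_one != 0.
Proof.
apply/eqP=> e; have /eqP := oner_neq0 A; apply.
by apply: (@bc_vec_inj _ _ iota); rewrite bc_vec0.
Qed.

HB.instance Definition _ := GRing.Zmodule_isNzRing.Build AL
  bc_mulA bc_mul1l bc_mul1r bc_mulDl bc_mulDr bc_one_neq0.

Lemma bc_scalerAl (a : L) (x y : AL) : a *: (x * y) = (a *: x) * y.
Proof. exact: bc_act_scalel. Qed.

HB.instance Definition _ := GRing.Lmodule_isLalgebra.Build L AL bc_scalerAl.

Lemma bc_scalerAr (a : L) (x y : AL) : a *: (x * y) = x * (a *: y).
Proof. exact: bc_act_scaler. Qed.

HB.instance Definition _ := GRing.Lalgebra_isAlgebra.Build L AL bc_scalerAr.
HB.instance Definition _ := Algebra_isFalgebra.Build L AL.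

End BaseChangeAlgebra.

Section BaseChange.
Variables (K L : fieldType) (iota : {rmorphism K -> L}) (A : superalgebra K).

Lemma bc_salg_mul_part p q (x y : bc_algebra iota A) :
  x \in bc_sub iota (salg_part A p) -> y \in bc_sub iota (salg_part A q) ->
  x * y \in bc_sub iota (salg_part A (p (+) q)).
Proof.
apply: bc_act_sub => a b Aa Ab; rewrite lfunE; exact: salg_mul_part.
Qed.

Definition bc_superalgebra : superalgebra L :=
  @SuperAlgebra L (bc_algebra iota A) (fun p => bc_sub iota (salg_part A p))
    (bc_sub_grading iota (salg_grading A)) bc_salg_mul_part.

Variable V : supermodule A.

Lemma bc_smod_act1 :
  bc_act iota (smod_act V) (1 : bc_superalgebra) = \1%VF.
Proof. by rewrite bc_actE smod_act1 bc_hom1. Qed.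

Lemma bc_smod_actM (x y : bc_superalgebra) :
  bc_act iota (smod_act V) (x * y) =
  (bc_act iota (smod_act V) x \o bc_act iota (smod_act V) y)%VF.
Proof. by apply: bc_actM => a b; rewrite lfunE smod_actM. Qed.

Definition bc_supermodule : supermodule bc_superalgebra :=
  @SuperModule L bc_superalgebra 'rV[L]_(\dim {: V})
    (fun p => bc_sub iota (smod_part V p)) (bc_act iota (smod_act V))
    (bc_sub_grading iota (smod_grading V)) bc_smod_act1 bc_smod_actM
    (fun p q => bc_act_sub (@smod_act_part K A V p q)).

End BaseChange.

Definition split_supermodule (K : fieldType) (A : superalgebra K)
    (V : supermodule A) : Prop :=
  forall (L : fieldType) (iota : {rmorphism K -> L}),
    simple_supermodule (bc_supermodule iota V).

Definition split_superalgebra (K : fieldType) (A : superalgebra K) : Prop :=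
  forall V : supermodule A, simple_supermodule V -> split_supermodule V.

Section Forms.
Variables (K : fieldType) (A : superalgebra K).

Definition homogeneous_basis n (B : n.-tuple A) : Prop :=
  basis_of {: A} B /\ forall i, exists p, tnth B i \in salg_part A p.

(** Meaningful for nonzero homogeneous elements only. *)
Definition parity (a : A) : bool := a \in salg_part A true.

Definition gram n (t : {scalar A}) (B : n.-tuple A) : 'M[K]_n :=
  \matrix_(i, j) t (tnth B i * tnth B j).

Definition nondegenerate_form (t : {scalar A}) : Prop :=
  exists n (B : n.-tuple A), homogeneous_basis B /\ gram t B \in unitmx.

Definition symmetrizing_form (t : {scalar A}) : Prop :=
  [/\ forall a, a \in salg_part A true -> t a = 0,
      nondegenerate_form t &
      forall x y, t (x * y) = t (y * x)].

Definition supersymmetrizing_form (t : {scalar A}) : Prop :=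
  [/\ forall a, a \in salg_part A true -> t a = 0,
      nondegenerate_form t &
      forall p q x y, x \in salg_part A p -> y \in salg_part A q ->
        t (x * y) = (-1) ^+ (p && q) * t (y * x)].

Definition dual_basis n (t : {scalar A}) (B B' : n.-tuple A) : Prop :=
  forall i j, t (tnth B' i * tnth B j) = (i == j)%:R.

Variable V : supermodule A.

Definition even_map (f : 'End(V)) : Prop :=
  forall p v, v \in smod_part V p -> f v \in smod_part V p.

(** The trace of the restriction of [f] to the [f]-stable subspace [U]. *)
Definition trace_on (U : {vspace V}) (f : 'End(V)) : K :=
  \sum_(i < \dim U) coord (vbasis U) i (f (vbasis U)`_i).

Definition tr (f : 'End(V)) : K := trace_on fullv f.

Definition suptr (f : 'End(V)) : K :=
  trace_on (smod_part V false) f - trace_on (smod_part V true) f.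

(** I(f), computed with the basis [B] and its dual basis [B']: first for
    symmetric forms, then for supersymmetric ones. *)
Definition casimir n (B B' : n.-tuple A) (f : 'End(V)) (v : V) : V :=
  \sum_(i < n) smod_act V (tnth B' i) (f (smod_act V (tnth B i) v)).

Definition super_casimir n (B B' : n.-tuple A) (f : 'End(V)) (v : V) : V :=
  \sum_(i < n) (-1) ^+ parity (tnth B i) *:
    smod_act V (tnth B' i) (f (smod_act V (tnth B i) v)).

(** [s] is a Schur element of [V]. I(f) does not depend on the choice of the
    homogeneous basis, and [s] is unique when [V] is nonzero. *)
Definition schur_element (t : {scalar A}) (s : K) : Prop :=
  exists n (B B' : n.-tuple A),
    [/\ homogeneous_basis B, dual_basis t B B' &
        forall f, even_map f ->
          forall v, casimir B B' f v = (s * tr f) *: v].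

Definition super_schur_element (t : {scalar A}) (s : K) : Prop :=
  exists n (B B' : n.-tuple A),
    [/\ homogeneous_basis B, dual_basis t B B' &
        forall f, even_map f ->
          forall v, super_casimir B B' f v = (s * suptr f) *: v].

End Forms.

(* Main.v *)
From HB Require Import structures.
Require Import Defs.
From Stdlib Require Import Classical_Prop.
From mathcomp Require Import all_boot all_algebra falgebra fieldext.

Set Implicit Arguments.
Unset Strict Implicit.
Unset Printing Implicit Defensive.

Import GRing.Theory.
Local Open Scope ring_scope.

(** Write [eps = false] for a symmetric and [eps = true] for a supersymmetric
    form [t], and let [theta] be the identity, respectively the parity
    automorphism. Then [t (x * y) = t (y * theta x)] for all [x], [y], and
    both halves of the theorem become statements about the single operator
    [C(f) = sum_b (-1)^(eps |b|) b^v f b]. The identity behind everything is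
    [superform_casimir]: the sum of [(-1)^(eps |b|) t(x b y) b^v] is
    [y * theta x].

    Non-zero Schur elements force semisimplicity ([casimir_semisimple]). If
    [C(f) = 0] for every even [f] on a simple [V], then [0] is a Schur element
    of [V]; hence every simple [V] has an [f] with [C(f) <> 0]. Suppose the
    Jacobson radical contains [x <> 0]. The radical is stable under the parity
    automorphism, so, 2 being invertible, it contains a homogeneous [y <> 0].
    Take a minimal non-zero graded left ideal [I] inside [A y]; it is a simple
    module. Extending an [f] with [C(f) <> 0] to a linear map [A -> I], the
    operator becomes right multiplication by some [e] in [I] ([casimir_mulr]),
    so [I d <> 0] for a homogeneous component [d] of [e]. By minimality
    [I d = I], so [d = w d] for some [w = a y] in [I]; but [1 - a y] has a left
    inverse, so [d = 0], a contradiction.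

    Conversely let [A] be semisimple and [V] simple with a non-zero homogeneous
    vector [v0]. The annihilator of [v0] is a graded left ideal and has a right
    unit, hence [a |-> a v0] has an [A]-linear homogeneous section [iota]
    ([semisimple_section]). The even map [f(w) = t(iota w) v0] satisfies
    [C(f) = id], so the Schur element is non-zero
    ([semisimple_casimir_id], [semisimple_schur_neq0]).

    For type [M], splitness makes every even endomorphism scalar: a root of its
    characteristic polynomial exists over some extension [L], and the kernel of
    the shifted map is a non-zero submodule of the simple module [L (x) V]
    ([split_even_endo_scalar]). A non-zero odd endomorphism [phi] would have
    [phi^2 = c <> 0] and produce the odd element [u = iota (phi v0)] with
    [u^2 = - c e], where [e = iota v0]. Supersymmetry gives
    [t(u^2) = - t(u^2)], so [t e = 0], and then [t] vanishes on the left ideal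
    [A e], against non-degeneracy ([supersymmetric_odd_endo0]). *)

Lemma exists_minimum (T : Type) (P : T -> Prop) (m : T -> nat) x :
  P x -> exists2 y, P y & forall z, P z -> (m y <= m z)%N.
Proof.
have [n] := ubnP (m x); elim: n x => // n IHn x /ltnSE mx_le Px.
case: (classic (exists2 z, P z & (m z < m x)%N)) => [[z Pz mz]|no].
  exact: IHn z (leq_trans mz mx_le) Pz.
exists x => // z Pz; rewrite leqNgt; apply/negP => mz.
by apply: no; exists z.
Qed.

(** * Homogeneous components *)

Section Components.
Variables (K : fieldType) (V : vectType K) (G : bool -> {vspace V}).
Hypothesis gradG : grading G.

Definition component p : 'End(V) := daddv_pi (G p) (G (~~ p)).

Let capG p : (G p :&: G (~~ p))%VS = 0%VS.
Proof. by case: gradG => _; case: p; rewrite //= capvC. Qed.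

Let addG p : (G p + G (~~ p))%VS = fullv.
Proof. by case: gradG => + _; case: p; rewrite //= addvC. Qed.

Lemma component_mem p v : component p v \in G p.
Proof. exact: memv_pi. Qed.

Lemma component_add p v : component p v + component (~~ p) v = v.
Proof. by rewrite /component negbK daddv_pi_add // addG memvf. Qed.

Lemma component_id p v : v \in G p -> component p v = v.
Proof. exact: daddv_pi_id. Qed.

Lemma component_hom p q v : v \in G q -> component p v = if p == q then v else 0.
Proof.
move=> Gv; case: eqP => [->|/eqP pq]; first exact: component_id.
have := component_add q v; rewrite component_id // => /(canRL (addKr v)).
by rewrite addNr; case: p q pq {Gv} => [] [].
Qed.

Lemma grading_disjoint p v : v \in G p -> v \in G (~~ p) -> v = 0.
Proof.
by move=> Gv /(component_hom p); rewrite component_id // => ->; case: (p).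
Qed.

Lemma exists_component (W : vectType K) (g : 'Hom(V, W)) v :
  g v != 0 -> exists p, g (component p v) != 0.
Proof.
rewrite -{1}(component_add false v) linearD /=.
have [->|g0 _] := eqVneq (g (component false v)) 0; last by exists false.
by rewrite add0r; exists true.
Qed.

(** The intersection-and-sum condition on graded subspaces is awkward to use;
    stability under the two projections transfers along linear maps. *)
Lemma graded_subspaceP (W : {vspace V}) :
  graded_subspace G W <-> forall p w, w \in W -> component p w \in W.
Proof.
split=> [defW p w|stabW].
  rewrite {1}defW => /memv_addP[u0 /memv_capP[Wu0 Gu0] [u1 /memv_capP[Wu1 Gu1] ->]].
  rewrite linearD /= (component_hom _ Gu0) (component_hom _ Gu1).
  by apply: memvD; case: ifP => _ //; apply: mem0v.
apply/eqP; rewrite eqEsubv; apply/andP; split; last first.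
  by rewrite subv_add !capvSl.
apply/subvP => w Ww; rewrite -(component_add false w).
by apply: memv_add; rewrite memv_cap stabW ?component_mem.
Qed.

End Components.

Section HomogeneousMaps.
Variables (K : fieldType) (V W : vectType K).
Variables (G : bool -> {vspace V}) (H : bool -> {vspace W}).
Hypotheses (gradG : grading G) (gradH : grading H).
Variables (d : bool) (f : 'Hom(V, W)).
Hypothesis f_hom : forall p v, v \in G p -> f v \in H (d (+) p).

Lemma component_homogeneous p v : component H (d (+) p) (f v) = f (component G p v).
Proof.
rewrite -{1}(component_add gradG p v) !linearD /=.
rewrite (component_hom _ _ (f_hom (component_mem _ _ _))) // eqxx.
rewrite (component_hom _ _ (f_hom (component_mem _ _ _))) //.
by case: (d) (p) => [] []; rewrite addr0.
Qed.

Lemma graded_kernel : graded_subspace G (lker f).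
Proof.
apply/graded_subspaceP => // p v; rewrite !memv_ker -component_homogeneous.
by move/eqP->; rewrite linear0.
Qed.

Lemma graded_image (U : {vspace V}) :
  graded_subspace G U -> graded_subspace H (f @: U).
Proof.
move=> /(graded_subspaceP gradG) Ugr; apply/graded_subspaceP => // p _ /memv_imgP[u Uu ->].
by rewrite -[p](addKb d) component_homogeneous memv_img ?Ugr.
Qed.

End HomogeneousMaps.

(** * Left ideals and the Jacobson radical *)

Section LeftIdeals.
Variables (K : fieldType) (A : falgType K).
Implicit Types (I J N : {vspace A}).

Lemma left_ideal_cap I J : left_ideal I -> left_ideal J -> left_ideal (I :&: J).
Proof.
by move=> lI lJ a x /memv_capP[Ix Jx]; rewrite memv_cap lI ?lJ.
Qed.

Lemma left_ideal_add I J : left_ideal I -> left_ideal J -> left_ideal (I + J).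
Proof.
move=> lI lJ a _ /memv_addP[x Ix [y Jy ->]].
by rewrite mulrDr memv_add ?lI ?lJ.
Qed.

Lemma left_ideal_amulr I x : left_ideal I -> left_ideal (amulr x @: I).
Proof.
move=> lI a _ /memv_imgP[y Iy ->]; rewrite lfunE /= mulrA.
by apply/memv_imgP; exists (a * y); rewrite ?lI // lfunE.
Qed.

Lemma left_ideal_full I : left_ideal I -> 1 \in I -> I = fullv.
Proof.
move=> lI I1; apply/eqP; rewrite eqEsubv subvf /=; apply/subvP => x _.
by rewrite -[x]mulr1 lI.
Qed.

(** Finite dimension replaces Zorn: a proper left ideal of largest dimension
    containing [I] is maximal. *)
Lemma exists_maximal_left_ideal I :
  left_ideal I -> I <> fullv ->
  exists2 J, maximal_left_ideal J & (I <= J)%VS.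
Proof.
move=> lI In.
pose P J := [/\ left_ideal J, J <> fullv & (I <= J)%VS].
have [J [lJ Jn IJ] Jmax] := @exists_minimum _ P
  (fun J => \dim {: A} - \dim J)%N I (And3 lI In (subvv I)).
exists J => //; split=> // J' lJ' JJ'.
case: (classic (J' = fullv)) => [|J'n]; [by right | left].
have := Jmax J' (And3 lJ' J'n (subv_trans IJ JJ')) => le.
apply/esym/eqP; rewrite eqEdim JJ' /=.
move: le; have := dimvS (subvf J); have := dimvS (subvf J').
by move=> h1 h2; rewrite leq_sub2lE.
Qed.

(** Otherwise [A (1 - a x)] lies in a maximal left ideal; that ideal contains
    [x], hence also [1]. *)
Lemma jacobson_left_invertible (x a : A) :
  in_jacobson_radical x -> exists b, b * (1 - a * x) = 1.
Proof.
move=> Jx; pose I := (amulr (1 - a * x) @: fullv)%VS.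
have lI : left_ideal I by apply: left_ideal_amulr => b y _; apply: memvf.
case: (classic (I = fullv)) => [Ifull|In].
  have : 1 \in I by rewrite Ifull memvf.
  by case/memv_imgP => b _; rewrite lfunE; exists b.
have [J maxJ IJ] := exists_maximal_left_ideal lI In.
have [lJ Jn _] := maxJ; case: Jn; apply: left_ideal_full => //; rewrite -(subrK (a * x) 1) memvD //.
  by apply: (subvP IJ); apply/memv_imgP; exists 1; rewrite ?memvf // lfunE /= mul1r.
by apply: lJ; apply: Jx.
Qed.

(** A left ideal [D] of least dimension with [D + N = A] works: a non-zero [x]
    in the intersection of [D] and [N] avoids some maximal left ideal [I], and
    then [D :&: I] is a smaller ideal still supplementing [N], by the modular
    law. *)
Lemma semisimple_complement N : semisimple A -> left_ideal N ->
  exists D, [/\ left_ideal D, (D + N)%VS = fullv & (D :&: N)%VS = 0%VS].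
Proof.
move=> ssA lN.
have lfull : left_ideal (fullv : {vspace A}) by move=> a x _; apply: memvf.
have fullN : (fullv + N)%VS = fullv by apply/eqP; rewrite eqEsubv subvf addvSl.
have [D [lD DN] Dmin] := @exists_minimum _
  (fun D => left_ideal D /\ (D + N)%VS = fullv) (fun D => \dim D) fullv
  (conj lfull fullN).
exists D; split=> //; apply/eqP; rewrite -subv0; apply/subvP => x DNx.
rewrite memv0; apply/eqP; apply: ssA => I maxI; apply: NNPP => nIx.
have [lI In Imax] := maxI.
have IDN : (I + D :&: N)%VS = fullv.
  have [E|//] := Imax _ (left_ideal_add lI (left_ideal_cap lD lN)) (addvSl _ _).
  by case: nIx; rewrite -E; apply: (subvP (addvSr _ _)).
(* Modular law: [D = (D :&: I) + (D :&: N)], as [D :&: N] is inside [D]. *)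
have DI : (D :&: I + N)%VS = fullv.
  apply/eqP; rewrite eqEsubv subvf /= -DN subv_add addvSr andbT.
  apply/subvP => y Dy.
  have : y \in (I + D :&: N)%VS by rewrite IDN memvf.
  case/memv_addP => i Ii [z /memv_capP[Dz Nz] defy].
  rewrite defy memv_add // memv_cap Ii andbT.
  by rewrite -(addrK z i) -defy memvB.
have le : (\dim D <= \dim (D :&: I))%N := Dmin _ (conj (left_ideal_cap lD lI) DI).
have /eqP E : (D :&: I)%VS == D by rewrite eqEdim capvSl.
case: nIx; have /memv_capP[+ _] := DNx.
by rewrite -E => /memv_capP[].
Qed.

(** The right unit is the [N]-component of [1] along a complement of [N]. *)
Lemma left_ideal_right_unit N : semisimple A -> left_ideal N ->
  exists2 n, n \in N & forall x, x \in N -> x * n = x.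
Proof.
move=> ssA lN; have [D [lD DN cap0]] := semisimple_complement ssA lN.
have : 1 \in (D + N)%VS by rewrite DN memvf.
case/memv_addP => d Dd [n Nn def1]; exists n => // x Nx.
have defx : x = x * d + x * n by rewrite -mulrDr -def1 mulr1.
have : x * d \in (D :&: N)%VS.
  rewrite memv_cap lD //= -(addrK (x * n) (x * d)) -defx.
  by rewrite memvB ?lN.
by rewrite cap0 memv0 => /eqP xd0; rewrite {2}defx xd0 add0r.
Qed.

End LeftIdeals.

(** * The parity automorphism and supersymmetric forms *)

Lemma pchar_two_neq0 (K : fieldType) : 2%N \notin [pchar K] -> (2%:R : K) != 0.
Proof. by apply: contra => two0; rewrite inE /= two0. Qed.

Section Superalgebras.
Variables (K : fieldType) (A : superalgebra K).
Implicit Types (a x y : A) (p q eps : bool).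

Local Notation part := (salg_part A).
Local Notation gradA := (salg_grading A).

(** For homogeneous [x], the odd component of [n] contributes to [x * n = x]
    only in the degree opposite to that of [x]. *)
Lemma graded_right_unit (N : {vspace A}) n :
  graded_subspace part N -> (forall x, x \in N -> x * n = x) ->
  forall x, x \in N -> x * component part false n = x.
Proof.
move=> /(graded_subspaceP gradA) compN nP.
suff hom q x : x \in part q -> x \in N -> x * component part false n = x.
  move=> x Nx; rewrite -(component_add gradA false x) mulrDl.
  by rewrite !(hom _ _ (component_mem _ _ _)) ?compN.
move=> Ax Nx; apply/eqP; rewrite -subr_eq0; apply/eqP.
apply: (grading_disjoint gradA (p := q)).
  by rewrite memvB // -[q]addbF salg_mul_part ?component_mem.
rewrite -{2}(nP x Nx) -{2}(component_add gradA false n) mulrDr opprD addrA subrr sub0r.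
by rewrite memvN -(addbT q) salg_mul_part ?component_mem.
Qed.

(** The algebra is a graded left ideal of itself with right unit [1], so the
    even component of [1] is a right unit as well. *)
Lemma salg_one_even : 1 \in part false.
Proof.
have gA : graded_subspace part fullv.
  by apply/(graded_subspaceP gradA) => p x _; apply: memvf.
have := graded_right_unit gA (fun x _ => mulr1 x) (memvf 1).
by rewrite mul1r => <-; apply: component_mem.
Qed.

(** The identity for [eps = false], the parity automorphism for
    [eps = true]. *)
Definition twist eps : 'End(A) :=
  component part false + (-1) ^+ eps *: component part true.

Lemma twist_homogeneous eps p x : x \in part p -> twist eps x = (-1) ^+ (eps && p) *: x.
Proof.
move=> Ax; rewrite add_lfunE scale_lfunE !(component_hom gradA _ Ax).
by case: p {Ax}; rewrite ?andbF ?andbT ?scaler0 ?scale1r ?addr0 ?add0r.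
Qed.

Lemma twist_false x : twist false x = x.
Proof.
by rewrite add_lfunE scale_lfunE scale1r component_add //; apply: gradA.
Qed.

Lemma twistK eps : involutive (twist eps).
Proof.
move=> x; rewrite -[x](component_add gradA false) !linearD /=.
do 2!rewrite !(twist_homogeneous _ (component_mem _ _ _)) !linearZ /=.
by rewrite !scalerA -!signr_addb !addbb !scale1r.
Qed.

Lemma twistM eps x y : twist eps (x * y) = twist eps x * twist eps y.
Proof.
rewrite -[x](component_add gradA false) -[y](component_add gradA false).
rewrite !(mulrDl, mulrDr, linearD) /=.
have mulh p q : twist eps (component part p x * component part q y) =
    twist eps (component part p x) * twist eps (component part q y).
  rewrite !(twist_homogeneous _ (component_mem _ _ _)).
  rewrite (twist_homogeneous _ (salg_mul_part (component_mem _ _ _) (component_mem _ _ _))).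
  rewrite -scalerAl -scalerAr scalerA -signr_addb.
  by case: eps p q => [] [] [].
by rewrite !mulh.
Qed.

(** An automorphism permutes the maximal left ideals. *)
Lemma jacobson_twist eps x : in_jacobson_radical x -> in_jacobson_radical (twist eps x).
Proof.
move=> Jx I [lI In Imax]; rewrite memv_preim; apply: Jx; split.
- by move=> a y; rewrite -!memv_preim twistM; apply: lI.
- move=> full; apply: In; apply: left_ideal_full => //.
  by rewrite -[1](twistK eps) memv_preim full memvf.
move=> J lJ IJ.
have lTJ : left_ideal (twist eps @^-1: J)%VS.
  by move=> a y; rewrite -!memv_preim twistM; apply: lJ.
have preimK (U : {vspace A}) : (twist eps @^-1: (twist eps @^-1: U))%VS = U.
  by apply/vspaceP => y; rewrite -!memv_preim twistK.
have [|<-|full] := Imax _ lTJ.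
- apply/subvP => y Iy; rewrite -memv_preim; apply: (subvP IJ).
  by rewrite -memv_preim twistK.
- by left; rewrite preimK.
by right; rewrite -[J]preimK full; apply/vspaceP => y; rewrite -memv_preim !memvf.
Qed.

(** [(x + theta x) / 2] and [(x - theta x) / 2] are the components of [x]. *)
Lemma jacobson_component p x :
  2%N \notin [pchar K] -> in_jacobson_radical x ->
  in_jacobson_radical (component part p x).
Proof.
move=> /pchar_two_neq0 two0 Jx.
suff <- : 2%:R^-1 *: (x + (-1) ^+ p *: twist true x) = component part p x.
  by move=> I maxI; rewrite memvZ // memvD ?memvZ ?Jx //; apply: jacobson_twist.
rewrite -[x in LHS](component_add gradA false) !linearD /=.
rewrite !(twist_homogeneous _ (component_mem _ _ _)) /=.
case: p => /=; rewrite ?scaleN1r ?scale1r ?opprD ?opprK.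
  by rewrite addrACA scalerN subrr add0r -mulr2n -scaler_nat scalerA mulfV ?scale1r.
by rewrite addrACA scalerN subrr addr0 -mulr2n -scaler_nat scalerA mulfV ?scale1r.
Qed.

(** Common form of the symmetric case [eps = false] and the supersymmetric
    case [eps = true]. *)
Definition superform eps (t : {scalar A}) : Prop :=
  [/\ forall a, a \in part true -> t a = 0,
      nondegenerate_form t &
      forall p q x y, x \in part p -> y \in part q ->
        t (x * y) = (-1) ^+ [&& eps, p & q] * t (y * x)].

Lemma supersymmetrizing_superform t : supersymmetrizing_form t -> superform true t.
Proof. by []. Qed.

Lemma symmetrizing_superform t : symmetrizing_form t -> superform false t.
Proof. by case=> t1 tnd tC; split=> // p q x y _ _; rewrite mul1r. Qed.

(** The dual basis is read off the inverse Gram matrix. *)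
Lemma nondegenerate_dual_basis (t : {scalar A}) : nondegenerate_form t ->
  exists n (B B' : n.-tuple A), homogeneous_basis B /\ dual_basis t B B'.
Proof.
move=> [n [B [homB Gunit]]]; exists n, B.
exists [tuple \sum_j invmx (gram t B) i j *: tnth B j | i < n]; split=> // i k.
rewrite tnth_mktuple mulr_suml linear_sum /=.
have := mulVmx Gunit => /matrixP/(_ i k); rewrite !mxE => <-.
by apply: eq_bigr => j _; rewrite -scalerAl linearZ /= !mxE.
Qed.

Section DualBases.
Variables (eps : bool) (t : {scalar A}) (n : nat) (B B' : n.-tuple A).
Hypotheses (tP : superform eps t) (homB : homogeneous_basis B).
Hypothesis dualB : dual_basis t B B'.

(** The sign [(-1)^(|x||y|)] may be replaced by [(-1)^|x|]: the form vanishes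
    on [x * y] and [y * x] when the degrees differ. This removes all
    homogeneity assumptions from later computations. *)
Lemma superform_twist x y : t (x * y) = t (y * twist eps x).
Proof.
have [t1 _ tC] := tP.
rewrite -[x](component_add gradA false) -[y](component_add gradA false).
rewrite !(mulrDl, mulrDr, linearD) /=.
have mulh p q : t (component part p x * component part q y) =
    t (component part q y * twist eps (component part p x)).
  rewrite (twist_homogeneous _ (component_mem _ _ _)) -scalerAr linearZ /=.
  rewrite (tC p q) ?component_mem //.
  have [<-|pq] := eqVneq p q; first by rewrite andbb.
  rewrite (t1 (component part q y * _)) ?mulr0 //.
  have -> : true = q (+) p by case: p q pq => [] [].
  by rewrite salg_mul_part ?component_mem.
by rewrite !mulh addrACA.
Qed.

Lemma basis_expansion x : x = \sum_i t (tnth B' i * x) *: tnth B i.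
Proof.
have [/andP[/eqP spanB freeB] _] := homB.
have nthB (j : 'I_n) : B`_j = tnth B j by rewrite (tnth_nth 0).
have spanx : x \in <<B>>%VS by rewrite spanB memvf.
rewrite [LHS](coord_span spanx); apply: eq_bigr => i _.
rewrite nthB; congr (_ *: _).
rewrite [in RHS](coord_span spanx) mulr_sumr linear_sum /= (bigD1 i) //=.
rewrite -scalerAr linearZ /= nthB dualB eqxx mulr1 big1 ?addr0 // => j ji.
by rewrite -scalerAr linearZ /= nthB dualB eq_sym (negPf ji) mulr0.
Qed.

Lemma dual_basis_expansion x : x = \sum_i t (x * tnth B i) *: tnth B' i.
Proof.
have nthB' (j : 'I_n) : B'`_j = tnth B' j by rewrite (tnth_nth 0).
have coordB' (k : 'I_n -> K) j : t ((\sum_i k i *: B'`_i) * tnth B j) = k j.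
  rewrite mulr_suml linear_sum /= (bigD1 j) //= -scalerAl linearZ /= nthB'.
  rewrite dualB eqxx mulr1 big1 ?addr0 // => i ij.
  by rewrite -scalerAl linearZ /= nthB' dualB (negPf ij) mulr0.
have freeB' : free B'.
  by apply/freeP => k k0 i; rewrite -coordB' k0 mul0r linear0.
have spanx : x \in <<B'>>%VS.
  suff /andP[/eqP-> _] : basis_of {: A} B' by apply: memvf.
  have [basB _] := homB.
  by rewrite basisEfree freeB' subvf /= size_tuple -(size_basis basB).
rewrite [LHS](coord_span spanx); apply: eq_bigr => i _.
by rewrite nthB'; congr (_ *: _); rewrite [in RHS](coord_span spanx) coordB'.
Qed.

Lemma basis_twist i : twist eps (tnth B i) = (-1) ^+ (eps && parity (tnth B i)) *: tnth B i.
Proof.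
have [/andP[_ freeB] /(_ i)[p Bp]] := homB.
rewrite (twist_homogeneous _ Bp); congr ((-1) ^+ (_ && _) *: _); rewrite /parity.
case: p Bp => Bp; first by rewrite Bp.
apply/esym; apply: contraNF (free_not0 freeB (mem_tnth i B)) => Bp1.
by rewrite (grading_disjoint gradA Bp Bp1).
Qed.

(** Move [x] and then [b] to the right end by [superform_twist]: the sign is
    absorbed by [theta b], and [theta] is an involution. What remains is the
    expansion of [y * theta x] in the dual basis. *)
Lemma superform_casimir x y :
  \sum_i ((-1) ^+ (eps && parity (tnth B i)) * t (x * (tnth B i * y))) *: tnth B' i =
  y * twist eps x.
Proof.
rewrite [RHS]dual_basis_expansion; apply: eq_bigr => i _; congr (_ *: _).
transitivity (t (x * (twist eps (tnth B i) * y))).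
  by rewrite basis_twist -scalerAl -scalerAr linearZ.
by rewrite superform_twist -[X in t X = _]mulrA superform_twist twistK.
Qed.

End DualBases.
End Superalgebras.

(** * Endomorphisms of split simple modules *)

(** Adjoin a root of a non-constant factor of least degree, which is
    irreducible. *)
Lemma exists_root_extension (K : fieldType) (p : {poly K}) :
  (1 < size p)%N ->
  exists (L : fieldType) (iota : {rmorphism K -> L}) r, root (map_poly iota p) r.
Proof.
move=> p_gt1; have p0 : p != 0 by apply: contraTneq p_gt1 => ->; rewrite size_poly0.
have [q [q_gt1 qp] qmin] := @exists_minimum _
  (fun q : {poly K} => (1 < size q)%N /\ q %| p) (fun q => size q) p
  (conj p_gt1 (dvdpp p)).
have irr_q : irreducible_poly q.
  split=> // d d1 dq; have d0 : d != 0.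
    apply: contraTneq dq => ->; rewrite dvd0p; apply: contraTneq q_gt1 => ->.
    by rewrite size_poly0.
  have d_gt1 : (1 < size d)%N by rewrite ltn_neqAle eq_sym d1 size_poly_gt0.
  rewrite -(dvdp_size_eqp dq) eqn_leq dvdp_leq //.
    by rewrite (qmin d (conj d_gt1 (dvdp_trans dq qp))).
  by rewrite -size_poly_gt0 ltnW.
have [L _ [r rq _]] := irredp_FAdjoin irr_q.
exists L, (in_alg L), r; have [s ->] := dvdpP _ _ qp.
by rewrite rmorphM rootM rq orbT.
Qed.

(** The sign rule in a form valid for arbitrary [a]. *)
Lemma homogeneous_endo_twist (K : fieldType) (A : superalgebra K) (V : supermodule A)
    p (f : 'End(V)) a v :
  homogeneous_endo p f -> f (smod_act V a v) = smod_act V (twist A p a) (f v).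
Proof.
move=> [_ f_lin]; rewrite -[a](component_add (salg_grading A) false) [twist A p _]linearD /=.
rewrite !(twist_homogeneous _ (component_mem _ _ _)) !(linearD (smod_act V)) /=.
rewrite !add_lfunE (linearD f) /= !(f_lin _ _ _ (component_mem _ _ _)).
by rewrite !linearZ /= !scale_lfunE.
Qed.

(** After base change [f] has an eigenvalue [r], so the kernel of [f - r] is
    everything by simplicity. Comparing one non-zero coordinate shows that [r]
    already comes from [K]. *)
Lemma split_even_endo_scalar (K : fieldType) (A : superalgebra K)
    (V : supermodule A) (f : 'End(V)) :
  simple_supermodule V -> split_supermodule V -> homogeneous_endo false f ->
  exists c, forall v, f v = c *: v.
Proof.
move=> [V0 _] splitV f_endo; have [f_even _] := f_endo.
pose M : 'M[K]_(\dim {: V}) := \matrix_(i, j) coord (vbasis {: V}) j (f (vbasis {: V})`_i).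
have [|L [iota [r rM]]] := @exists_root_extension _ (char_poly M).
  by rewrite size_char_poly ltnS lt0n dimv_eq0; apply/eqP.
pose g : 'End(bc_supermodule iota V) := bc_hom iota f.
pose U := lker (g - r *: \1%VF).
have UP x : x \in U = (g x == r *: x).
  by rewrite memv_ker add_lfunE opp_lfunE scale_lfunE id_lfunE subr_eq0.
have g_even p x : x \in smod_part (bc_supermodule iota V) p ->
    g x \in smod_part (bc_supermodule iota V) p.
  move=> Vx; rewrite memv_preim.
  apply: (subvP _ x Vx); apply: bc_sub_le => v Vv.
  by rewrite -memv_preim bc_homE; apply/bc_vec_sub/f_even.
have subU : subsupermodule U.
  split.
    apply: (@graded_kernel _ _ _ _ _ (smod_grading _) (smod_grading _) false) => p x Vx.
    rewrite add_lfunE opp_lfunE scale_lfunE id_lfunE.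
    by rewrite memvB ?memvZ ?g_even.
  move=> a x; rewrite !UP => /eqP gx; rewrite /= /bc_act.
  rewrite !sum_lfunE linear_sum scaler_sumr; apply/eqP; apply: eq_bigr => i _.
  rewrite !scale_lfunE linearZ /= scalerA mulrC -scalerA; congr (_ *: _).
  rewrite -linearZ /= -gx -!comp_lfunE -!bc_hom_comp; congr (bc_hom iota _ _).
  by apply/lfunP => v; rewrite !comp_lfunE (homogeneous_endo_twist _ _ f_endo) twist_false.
have U0 : U <> 0%VS.
  have : eigenvalue (map_mx iota M) r by rewrite eigenvalue_root_char -map_char_poly.
  case/eigenvalueP => x xM x0 U0; case/negP: x0; rewrite -memv0 -U0 UP -xM.
  apply/eqP; rewrite [LHS]lfunE /=; congr (_ *m _).
  by apply/matrixP => i j; rewrite !mxE.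
have Ufull : U = fullv by case: (proj2 (splitV L iota) U subU).
have gE v : bc_vec iota (f v) = r *: bc_vec iota v.
  by rewrite -bc_homE; apply/eqP; rewrite -UP Ufull memvf.
have [c defr] : exists c, r = iota c.
  have [v v0] : exists v : V, v != 0.
    exists (vpick {: V}); rewrite vpick0; exact/eqP.
  have [i vi] : exists i, coord (vbasis {: V}) i v != 0.
    apply: NNPP => no; case/negP: v0; rewrite (coord_vbasis (memvf v)).
    rewrite big1 // => i _; case: (eqVneq (coord (vbasis {: V}) i v) 0) => [->|vi].
      by rewrite scale0r.
    by case: no; exists i.
  exists (coord (vbasis {: V}) i (f v) / coord (vbasis {: V}) i v).
  have /rowP/(_ i) := gE v; rewrite !mxE fmorph_div => ->.
  by rewrite mulfK // fmorph_eq0.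
exists c => v; apply: (@bc_vec_inj _ _ iota).
by rewrite gE -[c *: v]addr0 bc_vecP bc_vec0 addr0 defr.
Qed.

(** * Graded left ideals as modules *)

Section LeftIdealModule.
Variables (K : fieldType) (A : superalgebra K) (I : {vspace A}).
Hypotheses (lI : left_ideal I) (gI : graded_subspace (salg_part A) I).
Local Notation gradA := (salg_grading A).

Definition ideal_incl : 'Hom(subvs_of I, A) := linfun vsval.

Definition ideal_part p : {vspace subvs_of I} := (ideal_incl @^-1: salg_part A p)%VS.

Definition ideal_act (a : A) : 'End(subvs_of I) :=
  (linfun (vsproj I) \o amull a \o ideal_incl)%VF.

Lemma ideal_inclE v : ideal_incl v = vsval v. Proof. by rewrite lfunE. Qed.

Lemma ideal_actE a v : vsval (ideal_act a v) = a * vsval v.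
Proof. by rewrite !comp_lfunE ideal_inclE !lfunE /= vsprojK // lI // subvsP. Qed.

Lemma ideal_act_linear : linear ideal_act.
Proof.
by move=> c a b; apply/lfunP => v; apply: subvs_inj;
   rewrite ideal_actE add_lfunE scale_lfunE linearP /= !ideal_actE mulrDl scalerAl.
Qed.
HB.instance Definition _ := GRing.isLinear.Build K A 'End(subvs_of I) *:%R
  ideal_act ideal_act_linear.

Lemma ideal_partE p v : (v \in ideal_part p) = (vsval v \in salg_part A p).
Proof. by rewrite -memv_preim ideal_inclE. Qed.

Lemma ideal_grading : grading ideal_part.
Proof.
split; apply/eqP; last first.
  rewrite -subv0; apply/subvP => v /memv_capP[]; rewrite !ideal_partE memv0 => v0 v1.
  by apply/eqP/subvs_inj; rewrite linear0 (grading_disjoint gradA v0 v1).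
rewrite eqEsubv subvf /=; apply/subvP => v _.
have comp_in p : component (salg_part A) p (vsval v) \in I.
  by move/(graded_subspaceP gradA): gI; apply; apply: subvsP.
have -> : v = Subvs (comp_in false) + Subvs (comp_in true).
  by apply: subvs_inj; rewrite linearD /= component_add //; apply: gradA.
by rewrite memv_add // ideal_partE component_mem.
Qed.

Lemma ideal_act1 : ideal_act 1 = \1%VF.
Proof. by apply/lfunP => v; apply: subvs_inj; rewrite ideal_actE id_lfunE mul1r. Qed.

Lemma ideal_actM a b : ideal_act (a * b) = (ideal_act a \o ideal_act b)%VF.
Proof.
by apply/lfunP => v; apply: subvs_inj; rewrite comp_lfunE !ideal_actE mulrA.
Qed.

Lemma ideal_act_part p q a v :
  a \in salg_part A p -> v \in ideal_part q -> ideal_act a v \in ideal_part (p (+) q).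
Proof. by rewrite !ideal_partE ideal_actE; apply: salg_mul_part. Qed.

Definition ideal_supermodule : supermodule A :=
  SuperModule ideal_grading ideal_act1 ideal_actM ideal_act_part.

Lemma ideal_smod_actE a (v : ideal_supermodule) :
  vsval (smod_act ideal_supermodule a v) = a * vsval v.
Proof. exact: ideal_actE. Qed.

Lemma ideal_supermodule_simple : I != 0%VS ->
  (forall J : {vspace A}, left_ideal J -> graded_subspace (salg_part A) J ->
    (J <= I)%VS -> J != 0%VS -> J = I) ->
  simple_supermodule ideal_supermodule.
Proof.
move=> I0 Imin; split.
  move=> full0; case/eqP: I0; apply/eqP; rewrite -subv0; apply/subvP => x Ix.
  have : Subvs Ix \in (fullv : {vspace ideal_supermodule}) by apply: memvf.
  by rewrite full0 !memv0 => /eqP[->].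
move=> W [gW lW]; pose J := (ideal_incl @: W)%VS.
have JP v : vsval v \in J -> v \in W.
  by case/memv_imgP => w Ww; rewrite ideal_inclE => /subvs_inj->.
case: (eqVneq J 0%VS) => [J0|Jn]; [left | right]; apply/eqP.
  rewrite -subv0; apply/subvP => w Ww; rewrite memv0; apply/eqP/subvs_inj.
  have : ideal_incl w \in J by apply: memv_img.
  by rewrite J0 memv0 ideal_inclE linear0 => /eqP.
rewrite eqEsubv subvf; apply/subvP => v _; apply: JP.
rewrite (Imin J) ?subvsP //.
- move=> a _ /memv_imgP[w Ww ->]; rewrite ideal_inclE -ideal_actE -ideal_inclE.
  by apply/memv_img/lW.
- apply: (@graded_image _ _ _ ideal_part _ ideal_grading gradA false) => // p w.
  by rewrite ideal_partE ideal_inclE.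
by apply/subvP => _ /memv_imgP[w _ ->]; rewrite ideal_inclE subvsP.
Qed.

End LeftIdealModule.

(** * Semisimplicity from the Casimir operator *)

Section Higman.
Variables (K : fieldType) (A : superalgebra K).

(** One operator for both kinds of forms, so that the arguments below need no
    case distinction. It is called C(f) in comments. *)
Definition sgn_casimir eps n (B B' : n.-tuple A) (V : supermodule A) (f : 'End(V)) (v : V) : V :=
  \sum_(i < n) (-1) ^+ (eps && parity (tnth B i)) *:
    smod_act V (tnth B' i) (f (smod_act V (tnth B i) v)).

Variables (eps : bool) (t : {scalar A}) (n : nat) (B B' : n.-tuple A).
Hypotheses (tP : superform eps t) (homB : homogeneous_basis B).
Hypothesis dualB : dual_basis t B B'.
Local Notation gradA := (salg_grading A).

(** Expanding [F] in the basis reduces this to rank-one maps, for which it is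
    [superform_casimir]. It makes C(F) a right multiplication on [A]. *)
Lemma casimir_mulr (F : 'End(A)) x :
  \sum_i (-1) ^+ (eps && parity (tnth B i)) *: (tnth B' i * F (tnth B i * x)) =
  x * \sum_j twist A eps (tnth B' j) * F (tnth B j).
Proof.
have expF y : F y = \sum_j t (tnth B' j * y) *: F (tnth B j).
  rewrite {1}(basis_expansion homB dualB y) linear_sum.
  by apply: eq_bigr => j _; rewrite linearZ.
under eq_bigr do rewrite expF mulr_sumr scaler_sumr.
rewrite exchange_big mulr_sumr; apply: eq_bigr => j _ /=.
rewrite mulrA -(superform_casimir tP homB dualB) mulr_suml.
by apply: eq_bigr => i _; rewrite -scalerAr -scalerAl scalerA.
Qed.

(** A non-zero radical contains a minimal graded left ideal [I]. A map [f] on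
    [I] with [C(f) <> 0] provides a homogeneous [d] in [I] with [I d = I], which
    the left invertibility of [1 - a y] for [y] in the radical forbids. *)
Lemma casimir_semisimple : 2%N \notin [pchar K] ->
  (forall V : supermodule A, simple_supermodule V ->
     exists (f : 'End(V)) v, sgn_casimir eps B B' f v != 0) ->
  semisimple A.
Proof.
move=> char2 casV x Jx; apply: NNPP => x0.
have [p y0] : exists p, component (salg_part A) p x != 0.
  have [|p] := @exists_component _ _ _ gradA _ \1%VF x.
    by rewrite id_lfunE; apply/eqP.
  by rewrite id_lfunE; exists p.
set y := component _ p x in y0.
have Jy : in_jacobson_radical y by apply: jacobson_component.
have Ay : y \in salg_part A p by apply: component_mem.
pose P (J : {vspace A}) := [/\ left_ideal J, graded_subspace (salg_part A) J,
  (J <= amulr y @: fullv)%VS & J != 0%VS].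
have mulr_graded q z (J : {vspace A}) : z \in salg_part A q ->
    graded_subspace (salg_part A) J -> graded_subspace (salg_part A) (amulr z @: J).
  move=> Az; apply: (@graded_image _ _ _ _ _ gradA gradA q) => r w Aw.
  by rewrite lfunE /= addbC salg_mul_part.
have PAy : P (amulr y @: fullv)%VS.
  split=> //.
  - by apply: left_ideal_amulr => a b _; apply: memvf.
  - by apply: mulr_graded Ay _; apply/(graded_subspaceP gradA) => q w _; apply: memvf.
  apply: contraNneq y0 => yA0; rewrite -memv0 -yA0; apply/memv_imgP.
  by exists 1; rewrite ?memvf // lfunE /= mul1r.
(* Least dimension among the non-zero graded left ideals inside [A y]. *)
have [I [lI gI IAy I0] Imin] := exists_minimum (fun J => \dim J) PAy.
have IminE (J : {vspace A}) : left_ideal J -> graded_subspace (salg_part A) J ->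
    (J <= I)%VS -> J != 0%VS -> J = I.
  move=> lJ gJ JI J0; apply/eqP; rewrite eqEdim JI Imin //.
  by split=> //; apply: subv_trans IAy.
have [f [v fv0]] := casV _ (ideal_supermodule_simple lI gI I0 IminE).
(* Extend [f] to [A] by an arbitrary linear projection onto [I]. *)
pose F : 'End(A) := (ideal_incl I \o f \o linfun (vsproj I))%VF.
pose e := \sum_j twist A eps (tnth B' j) * F (tnth B j).
have Ie : e \in I.
  by apply: memv_suml => j _; apply: (lI); rewrite !comp_lfunE ideal_inclE subvsP.
have ve0 : vsval v * e != 0.
  rewrite -casimir_mulr; apply: contraNneq fv0 => ve0.
  apply/eqP/subvs_inj; rewrite linear0 -[RHS]ve0 linear_sum; apply: eq_bigr => i _.
  rewrite linearZ; congr (_ *: _).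
  rewrite [LHS]ideal_smod_actE; congr (_ * _).
  rewrite !comp_lfunE !ideal_inclE; congr (vsval (f (fun_of_lfun _ _))).
  by rewrite lfunE.
have [q veq0] : exists q, vsval v * component (salg_part A) q e != 0.
  have [|q] := @exists_component _ _ _ gradA _ (amull (vsval v)) e; rewrite !lfunE //.
  by exists q.
set d := component _ q e in veq0.
have Id : d \in I by have /(graded_subspaceP gradA) compI := gI; apply: compI.
have Id_full : (amulr d @: I)%VS = I.
  apply: IminE; first exact: left_ideal_amulr.
  - by apply: (mulr_graded q) => //; apply: component_mem.
  - by apply/subvP => _ /memv_imgP[w Iw ->]; rewrite lfunE; apply: (lI).
  apply: contraNneq veq0 => Id0; rewrite -memv0 -Id0; apply/memv_imgP.
  by exists (vsval v); rewrite ?subvsP ?lfunE.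
have : d \in (amulr d @: I)%VS by rewrite Id_full.
case/memv_imgP => w Iw; rewrite lfunE /= => defd.
have /memv_imgP[a _ defw] := subvP IAy w Iw; rewrite lfunE /= in defw.
have [b ba] := jacobson_left_invertible a Jy.
case/negP: veq0; suff -> : d = 0 by rewrite mulr0.
by rewrite -[d]mul1r -ba -mulrA mulrBl mul1r -defw -defd subrr mulr0.
Qed.

End Higman.

(** * Simple modules over semisimple superalgebras *)

Section SimpleModules.
Variables (K : fieldType) (A : superalgebra K) (V : supermodule A).
Hypothesis simpleV : simple_supermodule V.
Local Notation gradA := (salg_grading A).
Local Notation gradV := (smod_grading V).

Lemma simple_homogeneous_vector : exists p v, v \in smod_part V p /\ v != 0.
Proof.
have [V0 _] := simpleV.
have [|p v0] := @exists_component _ _ _ gradV _ \1%VF (vpick {: V}).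
  by rewrite id_lfunE vpick0; apply/eqP.
rewrite id_lfunE in v0; exists p, (component (smod_part V) p (vpick {: V})).
by rewrite component_mem.
Qed.

Definition orbit_map (v : V) (a : A) : V := smod_act V a v.

Lemma orbit_map_linear v : linear (orbit_map v).
Proof. by move=> c a b; rewrite /orbit_map linearP add_lfunE scale_lfunE. Qed.
HB.instance Definition _ v := GRing.isLinear.Build K A V *:%R
  (orbit_map v) (orbit_map_linear v).

Section Generator.
Variables (p : bool) (v0 : V).
Hypotheses (Vv0 : v0 \in smod_part V p) (v0_neq0 : v0 != 0).
Let orb : 'Hom(A, V) := linfun (orbit_map v0).

Let orbE a : orb a = smod_act V a v0. Proof. by rewrite lfunE. Qed.

Let orb_hom q a : a \in salg_part A q -> orb a \in smod_part V (p (+) q).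
Proof. by move=> Aa; rewrite orbE addbC smod_act_part. Qed.

Lemma simple_cyclic : limg orb = fullv.
Proof.
have [_ /(_ (limg orb))[]] := simpleV.
- split.
    apply: (graded_image gradA gradV orb_hom).
    by apply/(graded_subspaceP gradA) => q w _; apply: memvf.
  move=> a _ /memv_imgP[b _ ->]; rewrite orbE -comp_lfunE -smod_actM -orbE.
  by rewrite memv_img ?memvf.
- move=> orb0; case/negP: v0_neq0; rewrite -memv0 -orb0; apply/memv_imgP.
  by exists 1; rewrite ?memvf // orbE smod_act1 id_lfunE.
by [].
Qed.

(** The orbit map [a |-> a v0] splits. If [n] is the even right unit of its
    kernel and [e = 1 - n], right multiplication by [e] kills the kernel and
    fixes the orbit map, so [a |-> a e] descends to [V]. *)
Lemma semisimple_section : semisimple A ->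
  exists iota : 'Hom(V, A),
    [/\ forall w, smod_act V (iota w) v0 = w,
        forall a w, iota (smod_act V a w) = a * iota w &
        forall q w, w \in smod_part V q -> iota w \in salg_part A (p (+) q)].
Proof.
move=> ssA; pose N := lker orb.
have lN : left_ideal N.
  move=> a x; rewrite !memv_ker !orbE smod_actM comp_lfunE => /eqP->.
  by rewrite linear0.
have gN : graded_subspace (salg_part A) N := graded_kernel gradA gradV orb_hom.
have [n Nn nP] := left_ideal_right_unit ssA lN.
pose e := 1 - component (salg_part A) false n.
have Ne x : orb x = 0 -> x * e = 0.
  move=> x0; rewrite mulrBr mulr1 (graded_right_unit gN nP) ?subrr //.
  by rewrite memv_ker x0.
have e_v0 : smod_act V e v0 = v0.
  have /(graded_subspaceP gradA) /(_ false n Nn) := gN.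
  by rewrite memv_ker -[RHS]subr0 => /eqP <-; rewrite -orbE linearB /= orbE smod_act1 id_lfunE.
pose s := (orb^-1)%VF.
have sK w : smod_act V (s w) v0 = w by rewrite -orbE limg_lfunVK // simple_cyclic memvf.
exists (amulr e \o s)%VF; split=> [w|a w|q w Vw]; rewrite comp_lfunE lfunE /=.
- by rewrite smod_actM comp_lfunE e_v0 sK.
- rewrite comp_lfunE lfunE /= mulrA; apply/eqP; rewrite -subr_eq0 -mulrBl; apply/eqP/Ne.
  by rewrite linearB /= !orbE smod_actM comp_lfunE !sK subrr.
have Ae : e \in salg_part A false by rewrite memvB ?salg_one_even ?component_mem.
rewrite -(component_add gradA (p (+) q) (s w)) mulrDl.
rewrite (Ne (component _ (~~ _) _)) ?addr0.
  by have := salg_mul_part (component_mem (salg_part A) (p (+) q) (s w)) Ae; rewrite addbF.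
rewrite -(component_homogeneous gradA gradV orb_hom) orbE sK.
by rewrite (component_hom gradV _ Vw) addbN addKb; case: (q).
Qed.

End Generator.

Section Semisimple.
Hypothesis ssA : semisimple A.
Variables (eps : bool) (t : {scalar A}) (n : nat) (B B' : n.-tuple A).
Hypotheses (tP : superform eps t) (homB : homogeneous_basis B).
Hypothesis dualB : dual_basis t B B'.

(** [C(f) = id] holds on the regular module for [f(x) = t(x) 1]; this is
    transported to [V] along the splitting [iota] of the orbit map, giving
    [f(w) = t(iota w) v0]. *)
Lemma semisimple_casimir_id : exists2 f : 'End(V),
  even_map f & forall v, sgn_casimir eps B B' f v = v.
Proof.
have [p [v0 [Vv0 v0_neq0]]] := simple_homogeneous_vector.
have [iota [iotaK iota_lin iota_hom]] := semisimple_section Vv0 v0_neq0 ssA.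
have [t1 _ _] := tP.
pose g w := t (iota w) *: v0.
have g_lin : linear g by move=> c v w; rewrite /g !linearP /= scalerDl scalerA.
pose gL : {linear V -> V} := HB.pack g (GRing.isLinear.Build _ _ _ _ _ g_lin).
exists (linfun gL) => [q v Vv | v].
  rewrite lfunE /= /g; have [->|qp] := eqVneq q p; first exact: memvZ.
  rewrite t1 ?scale0r ?mem0v //.
  have -> : true = p (+) q by case: p q qp {Vv0 Vv iota_hom} => [] [].
  exact: iota_hom.
transitivity (smod_act V (iota v * twist A eps 1) v0); last first.
  by rewrite (twist_homogeneous _ (salg_one_even A)) andbF scale1r mulr1 iotaK.
rewrite -(superform_casimir tP homB dualB) linear_sum sum_lfunE.
apply: eq_bigr => i _; rewrite lfunE /= /g iota_lin mul1r [in RHS]linearZ scale_lfunE /=.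
by rewrite linearZ scalerA.
Qed.

Lemma semisimple_schur_neq0 (tau : 'End(V) -> K) s :
  (forall f, even_map f -> forall v, sgn_casimir eps B B' f v = (s * tau f) *: v) ->
  s != 0.
Proof.
move=> sP; have [f f_even fP] := semisimple_casimir_id.
have [p [v [_ v_neq0]]] := simple_homogeneous_vector.
by apply: contraNneq v_neq0 => s0; rewrite -(fP v) sP // s0 mul0r scale0r.
Qed.

End Semisimple.
End SimpleModules.

(** * Type M *)

Section TypeM.
Variables (K : fieldType) (A : superalgebra K) (V : supermodule A) (t : {scalar A}).
Hypotheses (char2 : 2%N \notin [pchar K]) (ssA : semisimple A).
Hypotheses (tP : superform true t) (simpleV : simple_supermodule V).
Hypothesis splitV : split_supermodule V.
Local Notation gradA := (salg_grading A).
Local Notation gradV := (smod_grading V).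

(** Schur's lemma. *)
Lemma odd_endo_injective (f : 'End(V)) :
  homogeneous_endo true f -> f <> 0 -> lker f = 0%VS.
Proof.
move=> f_endo f0; have [f_hom _] := f_endo.
have [_ /(_ (lker f))[]] := simpleV => // [|full].
  split; first exact (graded_kernel gradV gradV f_hom).
  move=> a w; rewrite !memv_ker (homogeneous_endo_twist _ _ f_endo) => /eqP->.
  by rewrite linear0.
case: f0; apply/lfunP => v; rewrite zero_lfunE; apply/eqP.
by rewrite -memv_ker full memvf.
Qed.

Lemma homogeneous_endo_comp (p q : bool) (f g : 'End(V)) :
  homogeneous_endo p f -> homogeneous_endo q g -> homogeneous_endo (p (+) q) (f \o g)%VF.
Proof.
move=> [f_hom f_lin] [g_hom g_lin]; split=> r.
  by move=> v Vv; rewrite comp_lfunE -addbA f_hom ?g_hom.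
move=> a v Aa; rewrite !comp_lfunE (g_lin _ _ _ Aa) linearZ /= (f_lin _ _ _ Aa) scalerA -signr_addb.
by congr ((-1) ^+ nat_of_bool _ *: _); case: p q r {f_hom f_lin g_hom g_lin Aa} => [] [] [].
Qed.

(** With [e = iota v0], the products [a * e] are the values of [iota], and
    [e] acts as an identity on them from the right. An odd [f <> 0] yields an
    odd [u] with [u^2 = - c e] and [c <> 0]; as [t(u^2) = - t(u^2)], this gives
    [t e = 0]. Moving [e] around by supersymmetry shows that [t (iota w)] is a
    multiple of [t e], and so [a * e] is in the kernel of [t] for all [a]. *)
Lemma supersymmetric_odd_endo0 (f : 'End(V)) : homogeneous_endo true f -> f = 0.
Proof.
move=> f_endo; apply: NNPP => f0; have [f_hom f_lin] := f_endo.
have [p [v0 [Vv0 v0_neq0]]] := simple_homogeneous_vector simpleV.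
have [iota [iotaK iota_lin iota_hom]] := semisimple_section simpleV Vv0 v0_neq0 ssA.
have [t1 nondeg tC] := tP.
have [c ffE] := split_even_endo_scalar simpleV splitV (homogeneous_endo_comp f_endo f_endo).
have finj v : f v = 0 -> v = 0.
  by move=> fv0; apply/eqP; rewrite -memv0 -(odd_endo_injective f_endo f0) memv_ker fv0.
have c0 : c != 0.
  apply: contraNneq v0_neq0 => c0; apply/eqP/finj/finj.
  by rewrite -comp_lfunE ffE c0 scale0r.
set e := iota v0; pose u := iota (f v0).
have Au : u \in salg_part A true.
  by have := iota_hom _ _ (f_hom _ _ Vv0); rewrite addbCA addbb.
have fu : smod_act V u (f v0) = - c *: v0.
  have := f_lin _ _ v0 Au; rewrite iotaK -comp_lfunE ffE /= expr1 scaleN1r scaleNr => ->.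
  by rewrite opprK.
have uu : u * u = - c *: e by rewrite {2}/u -iota_lin fu linearZ.
have te : t e = 0.
  have /eqP := tC _ _ _ _ Au Au; rewrite mulN1r -subr_eq0 opprK -mulr2n -mulr_natl.
  rewrite mulf_eq0 (negPf (pchar_two_neq0 char2)) /= uu linearZ /= mulf_eq0 oppr_eq0 (negPf c0) /=.
  by move/eqP.
have t_iota w : t (iota w) = 0.
  suff th q : t (iota (component (smod_part V) q w)) = 0.
    by rewrite -(component_add gradV false w) !linearD /= !th addr0.
  have [->|qp] := eqVneq q p; last first.
    apply: t1; have -> : true = p (+) q by case: p q qp {Vv0 iota_hom} => [] [].
    exact/iota_hom/component_mem.
  move: (component _ p w) (component_mem (smod_part V) p w) => {}w Vw.
  (* Right multiplication by [w], seen on [V]: an even endomorphism, so scalar. *)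
  pose g : 'End(V) := (linfun (orbit_map w) \o iota)%VF.
  have gE v : g v = smod_act V (iota v) w by rewrite comp_lfunE lfunE.
  have [k gk] : exists k, forall v, g v = k *: v.
    apply: split_even_endo_scalar => //; split=> [q' v Vv|q' a v Aa]; rewrite !gE.
      by have := smod_act_part (iota_hom _ _ Vv) Vw; rewrite addbC addKb addFb.
    by rewrite scale1r iota_lin smod_actM comp_lfunE.
  rewrite -{1}(iotaK w) iota_lin (superform_twist tP).
  have Aiw : iota w \in salg_part A false by have := iota_hom _ _ Vw; rewrite addbb.
  by rewrite (twist_homogeneous _ Aiw) scale1r -iota_lin -gE gk !linearZ /= te mulr0.
have [n [B [B' [homB dualB]]]] := nondegenerate_dual_basis nondeg.
case/negP: v0_neq0; rewrite -(iotaK v0) -/e (basis_expansion homB dualB e) big1 => [|i _].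
  by rewrite linear0 zero_lfunE.
by rewrite -iota_lin t_iota scale0r.
Qed.

Lemma supersymmetric_typeM : typeM V.
Proof.
exists <[\1%VF]>%VS; last first.
  rewrite dim_vline; case: eqP => // one0; have [p [v [_]]] := simple_homogeneous_vector simpleV.
  by rewrite -[v]id_lfunE one0 zero_lfunE eqxx.
move=> f; split=> [/vlineP[k ->]|[f0 [f1 [-> f0_endo /supersymmetric_odd_endo0->]]]].
  exists (k *: \1%VF), 0; split; first by rewrite addr0.
    split=> [q v Vv|q a v _]; rewrite !scale_lfunE !id_lfunE ?memvZ //.
    by rewrite scale1r linearZ.
  by split=> [q v _|q a v _]; rewrite !zero_lfunE ?mem0v // linear0 scaler0.
have [k f0E] := split_even_endo_scalar simpleV splitV f0_endo.
apply/vlineP; exists k; rewrite addr0; apply/lfunP => v.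
by rewrite f0E scale_lfunE id_lfunE.
Qed.

End TypeM.

(** * Schur elements *)

(** The functional [tau] stands for the trace or the supertrace. If C(f)
    vanished for all even [f], then [0] would be a Schur element whatever
    [tau] is. *)
Lemma schur_semisimple (K : fieldType) (A : superalgebra K) (t : {scalar A}) eps
    (tau : forall V : supermodule A, 'End(V) -> K) :
  2%N \notin [pchar K] -> superform eps t ->
  (forall V : supermodule A, simple_supermodule V ->
    forall s, (exists n (B B' : n.-tuple A), [/\ homogeneous_basis B, dual_basis t B B' &
      forall f, even_map f ->
        forall v : V, sgn_casimir eps B B' f v = (s * tau V f) *: v]) -> s != 0) ->
  semisimple A.
Proof.
move=> char2 tP schurP; have [_ nondeg _] := tP.
have [n [B [B' [homB dualB]]]] := nondegenerate_dual_basis nondeg.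
apply: (casimir_semisimple tP homB dualB char2) => V simpleV; apply: NNPP => no.
suff /eqP : (0 : K) != 0 by [].
apply: (schurP V simpleV); exists n, B, B'; split=> // f _ v.
by rewrite mul0r scale0r; apply/eqP/negP => /negP fv0; apply: no; exists f, v.
Qed.

Lemma casimirE (K : fieldType) (A : superalgebra K) (V : supermodule A) n
    (B B' : n.-tuple A) (f : 'End(V)) v :
  casimir B B' f v = sgn_casimir false B B' f v.
Proof. by apply: eq_bigr => i _; rewrite scale1r. Qed.

Theorem theorem2p11 (K : fieldType) (char_neq2 : 2%N \notin [pchar K])
    (A : superalgebra K) (t : {scalar A})
    (t_form : symmetrizing_form t \/ supersymmetrizing_form t)
    (A_split : split_superalgebra A) :
  (symmetrizing_form t ->
     (semisimple A <->
      forall V : supermodule A, simple_supermodule V ->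
        forall s : K, schur_element V t s -> s != 0)) /\
  (supersymmetrizing_form t ->
     (semisimple A <->
      (forall V : supermodule A, simple_supermodule V -> typeM V) /\
      (forall V : supermodule A, simple_supermodule V ->
        forall s : K, super_schur_element V t s -> s != 0))).
Proof.
split=> [/symmetrizing_superform tP | /supersymmetrizing_superform tP]; split.
- move=> ssA V simpleV s [n [B [B' [homB dualB sP]]]].
  apply: (semisimple_schur_neq0 simpleV ssA tP homB dualB (tau := @tr _ _ _)) => f f_even v.
  by rewrite -casimirE sP.
- move=> schurP; apply: (schur_semisimple (tau := @tr K A) char_neq2 tP).
  move=> V simpleV s [n [B [B' [homB dualB sP]]]]; apply: (schurP V simpleV).
  by exists n, B, B'; split=> // f f_even v; rewrite casimirE sP.
- move=> ssA; split=> V simpleV.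
    exact: supersymmetric_typeM char_neq2 ssA tP simpleV (A_split V simpleV).
  move=> s [n [B [B' [homB dualB sP]]]].
  exact: (semisimple_schur_neq0 simpleV ssA tP homB dualB sP).
move=> [_ schurP]; exact: (schur_semisimple (tau := @suptr K A) char_neq2 tP schurP).
Qed.
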